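(* Let $\mathcal{H}$ be any class of hypotheses $h:X\to\{-1,+1\}$ (possibly infinite), equipped with a probability measure $\mu$, and let $D$ be a probability distribution on $X\times\{-1,+1\}$. Let $\epsilon>0$ and let $V_\epsilon=\mu(\{h\in\mathcal{H}:\varepsilon(h)\le\epsilon\})$. Assume $\epsilon$ is large enough that $V_\epsilon>0$. Let $\eta>0$ and $\Delta\ge0$ be such that $\Delta\eta\le1/2$. Then for any $\gamma\ge\ln(8/V_\epsilon)/\eta$, $$\Pr_{(x,y)\sim D}[y\,\ell_\eta(x)\le0]\le2\left(1+(2/V_\epsilon)e^{-\eta\gamma}\right)(\epsilon+\gamma),$$ and $$\Pr_{(x,y)\sim D}[y\,\ell_\eta(x)\le2\Delta]\le(1+e^{2\Delta\eta})\left(1+(2/V_\epsilon)e^{\eta(2\Delta-\gamma)}\right)(\epsilon+\gamma)\le4\left(1+(2/V_\epsilon)e^{\eta(2\Delta-\gamma)}\right)(\epsilon+\gamma).$$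
   Context: For $h\in\mathcal{H}$, the true error is $\varepsilon(h)=\Pr_{(x,y)\sim D}[h(x)\ne y]$. For $\eta>0$ and $x\in X$, the true log ratio with respect to $\mu$ is $$\ell_\eta(x)=\frac1\eta\ln\left(\frac{\int_{\{h\in\mathcal{H}:h(x)=+1\}}e^{-\eta\varepsilon(h)}\,d\mu(h)}{\int_{\{h\in\mathcal{H}:h(x)=-1\}}e^{-\eta\varepsilon(h)}\,d\mu(h)}\right),$$ with the convention $\ell_\eta(x)=+\infty$ if the denominator is $0$ and $\ell_\eta(x)=-\infty$ if the numerator is $0$. Everything that needs to be measurable is assumed to be so: $X$ is a measurable space, the map $(h,x)\mapsto h(x)$ is jointly measurable on $\mathcal{H}\times X$, and in particular the sets $\{h\in\mathcal{H}:h(x)=+1\}$ (for all $x\in X$) and $\{h\in\mathcal{H}:\varepsilon(h)<r\}$ (for all $r\in\mathbb{R}$) are $\mu$-measurable. *)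

(* Defs.v *)
From HB Require Import structures.
From mathcomp Require Export all_boot all_order all_algebra.
From mathcomp Require Export all_classical all_reals all_analysis.

Set Implicit Arguments.
Unset Strict Implicit.
Unset Printing Implicit Defensive.

Import Order.TTheory GRing.Theory Num.Theory.
Import numFieldNormedType.Exports.

Local Open Scope classical_set_scope.
Local Open Scope ring_scope.

(* The label set {-1, +1} is represented by bool, with true for +1 and false
   for -1; label_val is the number denoted by a label. *)
Definition label_val (R : realType) (y : bool) : R := if y then 1 else -1.
Arguments label_val {R} y.

Section LogRatio.
Context {R : realType} {dH dX : measure_display}.
Context {H : measurableType dH} {X : measurableType dX}.

(* A hypothesis class is given by its index type H, carrying the sigma-algebra
   of the class, and the evaluation map ev, where ev h x stands for h(x).  A set
   of functions is its own index type. *)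
Implicit Types (ev : H -> X -> bool) (D : probability (X * bool)%type R).
Implicit Types (mu : probability H R).

Definition true_error ev D (h : H) : R :=
  fine (D [set z | ev h z.1 != z.2]).

Definition vote_weight ev mu D (eta : R) (x : X) (y : bool) : R :=
  \int[mu]_(h in [set h | ev h x = y]) expR (- (eta * true_error ev D h)).

(* At most one of the two weights vanishes when ev is jointly measurable, as
   they then sum to the mu-integral of a positive function; hence the order of
   the two tests is irrelevant. *)
Definition log_ratio ev mu D (eta : R) (x : X) : \bar R :=
  if vote_weight ev mu D eta x false == 0 then +oo%E
  else if vote_weight ev mu D eta x true == 0 then -oo%E
  else (eta^-1 * ln (vote_weight ev mu D eta x true /
                     vote_weight ev mu D eta x false))%:E.

Definition low_error_mass ev mu D (eps : R) : R :=
  fine (mu [set h | true_error ev D h <= eps]).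

End LogRatio.

(* Main.v *)
Require Import Defs.
From mathcomp Require Import all_boot all_order all_algebra.
From mathcomp Require Import all_classical all_reals all_analysis.
From mathcomp Require Import measurable_realfun.
From mathcomp Require Import ring lra.

Import Order.TTheory GRing.Theory Num.Theory.
Import numFieldNormedType.Exports.

Local Open Scope classical_set_scope.
Local Open Scope ring_scope.

(** Give each hypothesis h the weight w(h) = e^(-eta err(h)), let Z be the total
    weight and let W(x, y) be the weight of the hypotheses that misclassify the
    example (x, y).  The hypotheses that classify it correctly weigh Z - W, so
    the margin y l(x) is eta^-1 ln((Z - W) / W), and it is at most m exactly
    when Z <= (1 + e^(eta m)) W(x, y) ([small_marginE]; the infinite values of
    the log ratio fit this description as well).  By Markov's inequality this
    has probability at most (1 + e^(eta m)) E[W] / Z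
    ([small_margin_probability]).

    Exchanging the two integrals turns E[W] into the integral of err(h) w(h)
    over mu ([integral_wrong_weight]), so that E[W] / Z is the mean error of a
    hypothesis drawn with density w / Z.  Let r = eps + gamma.  Since
    t e^(-eta t) decreases for t >= 1 / eta, a hypothesis of error above r
    contributes at most r e^(-eta r), while one of error at most r contributes
    at most r w(h): the integral is at most r Z + r e^(-eta r)
    ([mul_expRN_le]).  The hypotheses of error at most eps alone give
    Z >= V e^(-eta eps) ([le_total_weight]), hence
    E[W] / Z <= r (1 + e^(-eta gamma) / V) ([integral_wrong_weight_le]).

    The lower bound on gamma ensures eta gamma >= 1, so that r lies in the range
    where t e^(-eta t) decreases.  The announced bounds are the cases m = 0 and
    m = 2 Delta, weakened by 1 / V <= 2 / V and, in the second case, by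
    e^(-eta gamma) <= e^(eta (2 Delta - gamma)); the constant 4 comes from
    1 + e <= 4. *)

(** * Exponential inequalities *)

Lemma expR1_le3 (R : realType) : expR 1 <= 3 :> R.
Proof.
(* e^(-1/6) >= 5/6 gives e <= (6/5)^6 = 2.98...; sixth powers are the first
   for which this method falls below 3. *)
have e1 : 5 / 6 <= expR (- (1 / 6)) :> R.
  by apply: le_trans (expR_ge1Dx _); lra.
have e6 : (5 / 6) ^+ 6 <= expR (- (1 / 6)) ^+ 6 :> R.
  by rewrite ler_pXn2r// nnegrE ?expR_ge0//; lra.
move: e6; rewrite -expRM_natl.
have -> : 6 * - (1 / 6) = - 1 :> R by field.
rewrite expRN => e6.
rewrite -(invrK (expR 1)) invf_ple ?posrE ?invr_gt0 ?expR_gt0//.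
apply: le_trans e6; lra.
Qed.

(** The two terms on the right serve the cases t <= r and t > r.  In the second
    case e^(eta (t - r)) >= 1 + eta (t - r) >= t / r, because eta r >= 1; this
    is the decrease of t e^(-eta t) beyond 1 / eta, obtained without a
    derivative. *)
Lemma mul_expRN_le (R : realType) (eta r t : R) :
  0 < eta -> 1 <= eta * r -> 0 <= t ->
  t * expR (- (eta * t)) <= r * expR (- (eta * t)) + r * expR (- (eta * r)).
Proof.
move=> eta0 etar t0.
have r0 : 0 < r by rewrite -(pmulr_rgt0 _ eta0); lra.
have [tr|rt] := leP t r.
  rewrite -[leLHS]addr0 lerD ?mulr_ge0 ?expR_ge0 ?(ltW r0)//.
  by rewrite ler_wpM2r ?expR_ge0.
rewrite -[leLHS]add0r lerD ?mulr_ge0 ?expR_ge0 ?(ltW r0)//.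
have -> : - (eta * r) = - (eta * t) + eta * (t - r) by ring.
rewrite expRD mulrCA mulrC ler_wpM2l ?expR_ge0//.
have le1 : r * (1 + eta * (t - r)) <= r * expR (eta * (t - r)).
  by rewrite ler_wpM2l ?(ltW r0)// expR_ge1Dx.
apply: le_trans le1.
have : 0 <= (eta * r - 1) * (t - r) by rewrite mulr_ge0//; lra.
lra.
Qed.

(** * Weights of the hypotheses *)

Section GibbsWeights.
Context {R : realType} {dH dX : measure_display}.
Context {H : measurableType dH} {X : measurableType dX}.
Context (ev : H -> X -> bool) (mu : probability H R).
Context (D : probability (X * bool)%type R) (eta : R).
Context (ev_meas :
  measurable_fun [set: H * X] (fun p : H * X => ev p.1 p.2)).

Definition gibbs_weight (h : H) : R := expR (- (eta * true_error ev D h)).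

Definition total_weight : R := \int[mu]_h gibbs_weight h.

Definition wrong_weight (z : X * bool) : R :=
  vote_weight ev mu D eta z.1 (~~ z.2).

Definition misclassified : set (H * (X * bool)) :=
  [set p | ev p.1 p.2.1 != p.2.2].

Lemma indic_misclassified h z :
  \1_misclassified (h, z) = (ev h z.1 != z.2)%:R :> R.
Proof.
rewrite indicE; congr (_ %:R); congr nat_of_bool.
by apply/idP/idP => [/set_mem|?]; [|exact/mem_set].
Qed.

(** * Measurability and integrability *)

Lemma measurable_misclassified : measurable misclassified.
Proof.
have mev : measurable_fun [set: H * (X * bool)] (fun p => ev p.1 p.2.1).
  apply: (measurableT_comp ev_meas (g := fun p => (p.1, p.2.1))).
  apply/measurable_fun_pairP; split; first exact: measurable_fst.
  exact: measurableT_comp measurable_fst measurable_snd.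
have my : measurable_fun [set: H * (X * bool)] (fun p => p.2.2).
  exact: measurableT_comp measurable_snd measurable_snd.
have mneq : measurable_fun [set: H * (X * bool)]
    (fun p => ev p.1 p.2.1 != p.2.2).
  rewrite (_ : (fun _ => _) =
    fun p : H * (X * bool) => if ev p.1 p.2.1 then ~~ p.2.2 else p.2.2).
    by apply: measurable_fun_ifT => //; exact: measurable_neg.
  by apply/funext => p; case: (ev _ _); case: (p.2.2).
by rewrite -[misclassified]setTI; exact: (mneq measurableT [set true]).
Qed.

Lemma measurable_voters x y : measurable [set h | ev h x = y].
Proof.
have mevx : measurable_fun [set: H] (ev ^~ x).
  exact: (measurableT_comp ev_meas (measurable_pair2 x)).
by rewrite -[X in measurable X]setTI; exact: (mevx measurableT [set y]).
Qed.

Lemma measurable_misclassified_by h : measurable [set z | ev h z.1 != z.2].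
Proof.
have := measurable_xsection h measurable_misclassified.
by rewrite (_ : xsection _ _ = [set z | ev h z.1 != z.2])//;
  apply/seteqP; split => z; rewrite /xsection/= inE.
Qed.

Lemma true_error_ge0 h : 0 <= true_error ev D h.
Proof. exact: fine_ge0. Qed.

Lemma EFin_true_error h : (true_error ev D h)%:E = D [set z | ev h z.1 != z.2].
Proof.
by rewrite fineK// fin_num_measure//; exact: measurable_misclassified_by.
Qed.

Lemma measurable_true_error : measurable_fun [set: H] (true_error ev D).
Proof.
apply/measurable_EFinP.
have := measurable_fun_xsection D measurable_misclassified.
apply: eq_measurable_fun => h _ /=; rewrite EFin_true_error; congr (D _).
by apply/seteqP; split => z; rewrite /xsection/= inE.
Qed.

Lemma measurable_gibbs_weight : measurable_fun [set: H] gibbs_weight.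
Proof.
apply: measurableT_comp => //; apply: measurableT_comp => //.
by apply: measurable_funM => //; exact: measurable_true_error.
Qed.

Context (eta_gt0 : 0 < eta).

Lemma integrable_gibbs_weight A : measurable A ->
  mu.-integrable A (EFin \o gibbs_weight).
Proof.
move=> mA.
apply: (le_integrable mA _ _ (finite_measure_integrable_cst mu 1 mA)).
  apply/measurable_EFinP; apply: measurable_funTS.
  exact: measurable_gibbs_weight.
move=> h _ /=; rewrite lee_fin ger0_norm ?expR_ge0// normr1.
by rewrite -expR0 ler_expR oppr_le0 mulr_ge0 ?true_error_ge0 ?(ltW eta_gt0).
Qed.

(** Writing the domain of integration as an indicator on the product space is
    what makes Tonelli's theorem applicable. *)
Lemma EFin_wrong_weight z : (wrong_weight z)%:E =
  (\int[mu]_h (gibbs_weight h * \1_misclassified (h, z))%:E)%E.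
Proof.
rewrite /wrong_weight /vote_weight fineK; last first.
  apply: integrable_fin_num; first exact: measurable_voters.
  by apply: integrable_gibbs_weight; exact: measurable_voters.
rewrite integral_mkcond; apply: eq_integral => h _.
rewrite patchE indic_misclassified.
have -> : (h \in [set h | ev h z.1 = ~~ z.2]) = (ev h z.1 != z.2).
  apply/idP/idP => [/set_mem/= ->|neq]; first by case: z.2.
  by apply/mem_set => /=; move: neq; case: (ev h z.1) z.2 => -[].
by case: ifP => _; rewrite ?mulr1 ?mulr0.
Qed.

Lemma vote_weight_ge0 x y : 0 <= vote_weight ev mu D eta x y.
Proof. by apply: Rintegral_ge0 => h _; exact: expR_ge0. Qed.

Lemma vote_weightD x y :
  vote_weight ev mu D eta x y + vote_weight ev mu D eta x (~~ y) = total_weight.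
Proof.
rewrite /vote_weight -Rintegral_setU.
- congr (Rintegral _ _ _); apply/seteqP; split => // h _ /=.
  by case: (ev h x) y => -[]; [left|right|right|left].
- exact: measurable_voters.
- exact: measurable_voters.
- apply: integrable_gibbs_weight.
  by apply: measurableU; exact: measurable_voters.
- by apply/disj_setPS => h /= [->]; case: y.
Qed.

Lemma measurable_gibbs_misclassified :
  measurable_fun [set: H * (X * bool)]
    (fun p => (gibbs_weight p.1 * \1_misclassified p)%:E).
Proof.
apply/measurable_EFinP; apply: measurable_funM.
  by apply: measurableT_comp => //; exact: measurable_gibbs_weight.
exact: measurable_indic measurable_misclassified.
Qed.

Lemma gibbs_misclassified_ge0 p :
  (0 <= (gibbs_weight p.1 * \1_misclassified p)%:E)%E.
Proof. by rewrite lee_fin mulr_ge0 ?expR_ge0. Qed.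

Lemma measurable_wrong_weight : measurable_fun [set: X * bool] wrong_weight.
Proof.
apply/measurable_EFinP.
have := measurable_fun_fubini_tonelli_G (m1 := mu) _
  measurable_gibbs_misclassified gibbs_misclassified_ge0.
by apply: eq_measurable_fun => z _; rewrite /= EFin_wrong_weight.
Qed.

(** * Mean error under the Gibbs weights *)

(** Tonelli: integrating the indicator of an error over the examples first
    leaves the true error of the hypothesis. *)
Lemma integral_wrong_weight :
  (\int[D]_z (wrong_weight z)%:E =
   \int[mu]_h (true_error ev D h * gibbs_weight h)%:E)%E.
Proof.
under eq_integral do rewrite EFin_wrong_weight.
rewrite -(fubini_tonelli _ measurable_gibbs_misclassified)//; last first.
  exact: gibbs_misclassified_ge0.
apply: eq_integral => h _ /=.
under eq_integral do rewrite EFinM.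
rewrite ge0_integralZl_EFin ?expR_ge0//; last first.
  apply/measurable_EFinP; apply: measurableT_comp => //.
  exact: measurable_indic measurable_misclassified.
rewrite mulrC EFinM EFin_true_error; congr (_ * _)%E.
rewrite -[X in D X]setIT -integral_indic//.
exact: measurable_misclassified_by.
Qed.

Context (eps : R).
Local Notation V := (low_error_mass ev mu D eps).

Lemma measurable_low_error : measurable [set h | true_error ev D h <= eps].
Proof.
rewrite -[X in measurable X]setTI.
exact: measurable_fun_le measurable_true_error _.
Qed.

Lemma EFin_low_error_mass :
  V%:E = mu [set h | true_error ev D h <= eps].
Proof. by rewrite fineK// fin_num_measure//; exact: measurable_low_error. Qed.

Lemma EFin_total_weight : total_weight%:E = (\int[mu]_h (gibbs_weight h)%:E)%E.
Proof.
rewrite fineK//; apply: integrable_fin_num => //.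
exact: integrable_gibbs_weight.
Qed.

(** Only the hypotheses of error at most eps are kept; each weighs at least
    e^(-eta eps). *)
Lemma le_total_weight : V * expR (- (eta * eps)) <= total_weight.
Proof.
have mlow : measurable_fun [set: H]
    (EFin \o (\1_[set h | true_error ev D h <= eps] : H -> R)).
  by apply/measurable_EFinP; exact: measurable_indic measurable_low_error.
rewrite -lee_fin EFin_total_weight EFinM EFin_low_error_mass.
rewrite -[X in mu X]setIT -integral_indic//; last exact: measurable_low_error.
rewrite muleC -ge0_integralZl_EFin ?expR_ge0//.
apply: ge0_le_integral => //.
- exact: measurable_funeM mlow.
- by apply/measurable_EFinP; exact: measurable_gibbs_weight.
- move=> h _; rewrite -EFinM lee_fin indicE.
  have [/set_mem/= heps|_] := boolP (h \in _);
    rewrite ?mulr0 ?mulr1 ?expR_ge0//.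
  by rewrite ler_expR lerN2 ler_wpM2l ?(ltW eta_gt0).
Qed.

Context (V_gt0 : 0 < V).

Lemma total_weight_gt0 : 0 < total_weight.
Proof. by apply: lt_le_trans le_total_weight; rewrite mulr_gt0 ?expR_gt0. Qed.

Lemma low_error_mass_le1 : V <= 1.
Proof.
rewrite -lee_fin EFin_low_error_mass probability_le1//.
exact: measurable_low_error.
Qed.

(** Hypotheses of error above eps + gamma add at most
    (eps + gamma) e^(-eta (eps + gamma)) to the integral.  By the lower bound
    V e^(-eta eps) on the total weight Z, this is at most
    (eps + gamma) (e^(-eta gamma) / V) Z. *)
Lemma integral_wrong_weight_le (gamma : R) : 1 <= eta * (eps + gamma) ->
  (\int[D]_z (wrong_weight z)%:E <=
   ((1 + V^-1 * expR (- (eta * gamma))) * (eps + gamma) * total_weight)%:E)%E.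
Proof.
set r := eps + gamma => etar.
have r0 : 0 < r by rewrite -(pmulr_rgt0 _ eta_gt0); lra.
have mgw : measurable_fun [set: H] (EFin \o gibbs_weight).
  by apply/measurable_EFinP; exact: measurable_gibbs_weight.
rewrite integral_wrong_weight.
apply: (@le_trans _ _ (\int[mu]_h
    (r%:E * (gibbs_weight h)%:E + (r * expR (- (eta * r)))%:E))%E).
  apply: ge0_le_integral => //.
  - by move=> h _; rewrite lee_fin mulr_ge0 ?true_error_ge0 ?expR_ge0.
  - apply/measurable_EFinP; apply: measurable_funM.
      exact: measurable_true_error.
    exact: measurable_gibbs_weight.
  - by apply: emeasurable_funD => //; exact: measurable_funeM.
  - move=> h _; rewrite -EFinM -EFinD lee_fin.
    exact: mul_expRN_le (true_error_ge0 h).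
rewrite ge0_integralD//; first last.
- by move=> h _; rewrite lee_fin mulr_ge0 ?expR_ge0 ?(ltW r0).
- exact: measurable_funeM.
- by move=> h _; rewrite -EFinM lee_fin mulr_ge0 ?expR_ge0 ?(ltW r0).
rewrite ge0_integralZl_EFin ?(ltW r0)//; last first.
  by move=> h _; rewrite lee_fin expR_ge0.
rewrite -EFin_total_weight integral_cst//= probability_setT mule1 -EFinM -EFinD.
rewrite lee_fin.
have -> : expR (- (eta * r)) =
    V^-1 * expR (- (eta * gamma)) * (V * expR (- (eta * eps))).
  rewrite mulrACA mulVf ?gt_eqF// mul1r -expRD; congr expR.
  by rewrite /r; ring.
have B0 : 0 <= r * (V^-1 * expR (- (eta * gamma))).
  by rewrite mulr_ge0 ?mulr_ge0 ?expR_ge0 ?invr_ge0 ?(ltW r0) ?(ltW V_gt0).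
by have := ler_wpM2l B0 le_total_weight; lra.
Qed.

(** * The small-margin event *)

(** Exponentiating the log ratio compares the weight of the correct votes with
    that of the wrong ones; adding the wrong weight to both sides replaces the
    former by the total weight, which does not depend on the example.  When one
    weight vanishes the infinite log ratio gives the same answer, because the
    total weight is positive. *)
Lemma small_marginE (m : R) z :
  ((label_val z.2)%:E * log_ratio ev mu D eta z.1 <= m%:E)%E =
  (total_weight <= (1 + expR (eta * m)) * wrong_weight z).
Proof.
have ln_le (a b : R) : 0 < a -> 0 < b ->
    (eta^-1 * ln (a / b) <= m) = (a <= expR (eta * m) * b).
  move=> a0 b0; rewrite [eta^-1 * _]mulrC ler_pdivrMr// [m * _]mulrC.
  rewrite -[LHS]ler_expR.
  by rewrite lnK ?posrE ?divr_gt0// ler_pdivrMr.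
case: z => x y /=; rewrite /wrong_weight/= /log_ratio.
set vy := vote_weight _ _ _ _ _ (~~ y).
have -> : (total_weight <= (1 + expR (eta * m)) * vy) =
    (vote_weight ev mu D eta x y <= expR (eta * m) * vy).
  by rewrite -(vote_weightD x y) mulrDl mul1r addrC lerD2l.
rewrite {}/vy.
have := total_weight_gt0; rewrite -(vote_weightD x true) /=.
have := vote_weight_ge0 x true; have := vote_weight_ge0 x false.
case: y => /=; move: (vote_weight _ _ _ _ x true) (vote_weight _ _ _ _ x false);
  move=> wt wf wf_ge0 wt_ge0 Z_gt0; rewrite ?mul1e ?mulN1e.
- have [wf0|wf_neq0] := eqVneq wf 0.
    move: Z_gt0; rewrite wf0 addr0 mulr0 leye_eq => wt_gt0.
    by rewrite leNgt wt_gt0.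
  have wf_gt0 : 0 < wf by rewrite lt_neqAle eq_sym wf_neq0.
  have [->|wt_neq0] := eqVneq wt 0.
    by rewrite leNye mulr_ge0 ?expR_ge0.
  by rewrite lee_fin ln_le// lt_neqAle eq_sym wt_neq0.
- have [->|wf_neq0] := eqVneq wf 0.
    by rewrite leNye mulr_ge0 ?expR_ge0.
  have wf_gt0 : 0 < wf by rewrite lt_neqAle eq_sym wf_neq0.
  have [->|wt_neq0] := eqVneq wt 0.
    by rewrite mulr0 leye_eq leNgt wf_gt0.
  have wt_gt0 : 0 < wt by rewrite lt_neqAle eq_sym wt_neq0.
  by rewrite /= lee_fin -mulrN -lnV ?posrE ?divr_gt0// invf_div ln_le.
Qed.

(** Markov's inequality: on the event, the wrong weight is at least the constant
    Z / (1 + e^(eta m)), Z being the total weight. *)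
Lemma small_margin_probability (gamma m : R) : 1 <= eta * (eps + gamma) ->
  (D [set z | (label_val z.2)%:E * log_ratio ev mu D eta z.1 <= m%:E] <=
   ((1 + expR (eta * m)) * (1 + V^-1 * expR (- (eta * gamma))) *
    (eps + gamma))%:E)%E.
Proof.
move=> etar; set c := 1 + expR (eta * m).
set k := (1 + V^-1 * expR (- (eta * gamma))) * (eps + gamma).
have c0 : 0 < c by rewrite addr_gt0 ?expR_gt0.
have Z0 := total_weight_gt0.
have mww := measurable_wrong_weight.
set A := [set z | _].
have AE : A = [set z | total_weight <= c * wrong_weight z].
  by apply/seteqP; split => z; rewrite /A/= small_marginE.
have mA : measurable A.
  rewrite AE -[X in measurable X]setTI; apply: measurable_fun_le => //.
  exact: measurable_funM.
have c_wrong : (\int[D]_z ((c / total_weight)%:E * (wrong_weight z)%:E) <=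
    (c / total_weight * (k * total_weight))%:E)%E.
  rewrite ge0_integralZl_EFin ?divr_ge0 ?(ltW c0) ?(ltW Z0)//; first last.
  - exact/measurable_EFinP.
  - by move=> z _; rewrite lee_fin vote_weight_ge0.
  rewrite [leRHS]EFinM lee_pmul2l// ?lte_fin ?divr_gt0//.
  exact: integral_wrong_weight_le.
rewrite -mulrA -/k.
have -> : c * k = c / total_weight * (k * total_weight).
  by field; rewrite !gt_eqF.
apply: le_trans c_wrong.
rewrite -[X in D X]setIT -integral_indic//.
apply: ge0_le_integral => //.
- exact/measurable_EFinP/measurable_indic.
- by apply: measurable_funeM; exact/measurable_EFinP.
move=> z _; rewrite -EFinM lee_fin indicE.
have [/set_mem|_] := boolP (z \in A).
  by rewrite AE/= mulrAC ler_pdivlMr// mul1r.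
by rewrite mulr_ge0 ?vote_weight_ge0// divr_ge0 ?(ltW c0) ?(ltW Z0).
Qed.

End GibbsWeights.

(** * Margin bounds for the averaged classifier *)

Theorem theorem7 (R : realType) (dH dX : measure_display)
    (H : measurableType dH) (X : measurableType dX)
    (ev : H -> X -> bool)
    (ev_meas : measurable_fun [set: H * X] (fun p : H * X => ev p.1 p.2))
    (mu : probability H R) (D : probability (X * bool)%type R)
    (eps : R) (eps_gt0 : 0 < eps)
    (V_gt0 : 0 < low_error_mass ev mu D eps)
    (eta Delta : R) (eta_gt0 : 0 < eta) (Delta_ge0 : 0 <= Delta)
    (Delta_eta : Delta * eta <= 1 / 2)
    (gamma : R)
    (gamma_ge : ln (8 / low_error_mass ev mu D eps) / eta <= gamma) :
  let V := low_error_mass ev mu D eps in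
  let ell := log_ratio ev mu D eta in
  (D [set z | (label_val z.2)%:E * ell z.1 <= 0]
     <= (2 * (1 + 2 / V * expR (- (eta * gamma))) * (eps + gamma))%:E)%E
  /\
  ((D [set z | (label_val z.2)%:E * ell z.1 <= (2 * Delta)%:E]
     <= ((1 + expR (2 * Delta * eta))
         * (1 + 2 / V * expR (eta * (2 * Delta - gamma)))
         * (eps + gamma))%:E)%E
   /\
   (1 + expR (2 * Delta * eta))
     * (1 + 2 / V * expR (eta * (2 * Delta - gamma))) * (eps + gamma)
   <= 4 * (1 + 2 / V * expR (eta * (2 * Delta - gamma))) * (eps + gamma)).
Proof.
move=> V ell.
have V_le1 : V <= 1 := low_error_mass_le1 ev mu D ev_meas eps.
(* e <= 3 <= 8 / V, so eta gamma >= ln (8 / V) >= 1. *)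
have eta_gamma : 1 <= eta * gamma.
  move: gamma_ge; rewrite ler_pdivrMr// [gamma * _]mulrC; apply: le_trans.
  rewrite -ler_expR lnK ?posrE ?divr_gt0//.
  apply: le_trans (expR1_le3 R) _; rewrite ler_pdivlMr//.
  by rewrite -/V; lra.
have gamma_gt0 : 0 < gamma by rewrite -(pmulr_rgt0 _ eta_gt0); lra.
have etar : 1 <= eta * (eps + gamma).
  by rewrite mulrDr; have := mulr_ge0 (ltW eta_gt0) (ltW eps_gt0); lra.
have margin m := small_margin_probability
  ev mu D eta ev_meas eta_gt0 eps V_gt0 gamma m etar.
have r0 : 0 <= eps + gamma by lra.
have slack t : 0 <= t -> 1 + V^-1 * expR (- (eta * gamma)) <=
    1 + 2 / V * expR (t - eta * gamma).
  move=> t0; rewrite lerD2l ler_pM ?expR_ge0 ?invr_ge0 ?(ltW V_gt0)//.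
    by rewrite ler_peMl ?invr_ge0 ?(ltW V_gt0)// ler1n.
  by rewrite ler_expR; lra.
split; [|split].
- apply: le_trans (margin 0) _; rewrite lee_fin mulr0 expR0.
  by rewrite ler_wpM2r// ler_wpM2l//; have := slack 0 (lexx 0); rewrite sub0r.
- apply: le_trans (margin (2 * Delta)) _; rewrite lee_fin.
  have -> : eta * (2 * Delta) = 2 * Delta * eta by ring.
  rewrite ler_wpM2r// ler_wpM2l ?addr_ge0 ?expR_ge0//.
  rewrite mulrBr; apply: slack.
  by rewrite !mulr_ge0// ltW.
- rewrite ler_wpM2r// ler_wpM2r//.
    by rewrite addr_ge0// !mulr_ge0 ?expR_ge0 ?invr_ge0 ?(ltW V_gt0).
  have : expR (2 * Delta * eta) <= expR 1 by rewrite ler_expR; lra.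
  by have := expR1_le3 R; lra.
Qed.
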